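(* Let $d\ge2$ and fix $p>0$. For each even integer $q>p$ let $\nu_q$ be any Borel probability measure on $\mathbb{RP}^{d-1}$ minimizing the energy of the kernel $L_{p,q}(x,y)=|x\cdot y|^p-\frac pq|x\cdot y|^q$ over Borel probability measures on $\mathbb{RP}^{d-1}$, and let $e_{p,q}=I_p(\nu_q)-\frac pq I_q(\nu_q)$. As even $q\to\infty$ with $p$ fixed, every weak cluster point of $\nu_q$ belongs to $\mathcal M_p$ and has purity $a_*(p)$, i.e. $A(\nu)=a_*(p)$ for every such cluster point $\nu$. Moreover, $$I_q(\nu_q)\longrightarrow a_*(p),\qquad I_p(\nu_q)-e(p)=o(q^{-1}),\qquad e_{p,q}=e(p)-\frac pq\,a_*(p)+o(q^{-1}).$$
   Context: Here $X=\mathbb{RP}^{d-1}$ is the set of lines in $\mathbb R^d$, each line represented by a unit vector $x$ up to sign; functions of $|x\cdot y|$ are well defined on $X\times X$. For $s>0$ and a Borel probability measure $\mu$ on $X$, $I_s(\mu)=\iint|x\cdot y|^s\,d\mu(x)\,d\mu(y)$, $e(p)=\min_\mu I_p(\mu)$ over Borel probability measures on $X$ (this equals the minimum over the sphere $\mathbb S^{d-1}$), and $\mathcal M_p$ is the set of minimizers of $I_p$ on $X$. The atomic purity is $$A(\mu)=(\mu\otimes\mu)(\Delta_X)=\sum_{x\in X}\mu\{x\}^2,\qquad a_*(p)=\max_{\mu\in\mathcal M_p}A(\mu),$$ where $\Delta_X$ is the diagonal of $X\times X$; the maximum exists since $A$ is upper semicontinuous for weak convergence. *)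

(* Defs.v *)
From HB Require Import structures.
From mathcomp Require Import all_boot all_order all_algebra.
From mathcomp Require Import all_classical all_reals all_analysis.

Set Implicit Arguments.
Unset Strict Implicit.
Unset Printing Implicit Defensive.

Import Order.TTheory GRing.Theory Num.Theory.
Import numFieldNormedType.Exports.

Local Open Scope classical_set_scope.
Local Open Scope ring_scope.

Definition dot (R : realType) (d : nat) (x y : 'rV[R]_d) : R :=
  \sum_(i < d) x 0 i * y 0 i.

Definition unit_vectors (R : realType) (d : nat) : set 'rV[R]_d :=
  [set x | dot x x = 1].

Arguments unit_vectors : clear implicits.

Definition sphere (R : realType) (d : nat) : Type := set_type (unit_vectors R d).

HB.instance Definition _ (R : realType) (d : nat) :=
  SubChoice.copy (sphere R d) (set_type (unit_vectors R d)).
HB.instance Definition _ (R : realType) (d : nat) :=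
  Topological.copy (sphere R d) (set_type (unit_vectors R d)).

Lemma delta_mx0_unit (R : realType) (n : nat) :
  delta_mx 0 0 \in unit_vectors R n.+1.
Proof.
rewrite inE /unit_vectors /= /dot big_ord_recl big1 ?addr0 => [|i _].
  by rewrite !mxE /= mulr1.
by rewrite !mxE /= mulr0.
Qed.

HB.instance Definition _ (R : realType) (n : nat) :=
  isPointed.Build (sphere R n.+1) (SigSub (delta_mx0_unit R n)).

Section antipodal.
Context (R : realType) (d : nat).
Implicit Types x y : sphere R d.

Definition antipodal x y : bool := (x == y) || (\val x == - \val y).

Lemma antipodal_refl : reflexive antipodal.
Proof. by move=> x; rewrite /antipodal eqxx. Qed.

Lemma antipodal_sym : symmetric antipodal.
Proof.
by move=> x y; rewrite /antipodal eq_sym -eqr_oppLR [in X in _ || X]eq_sym.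
Qed.

Lemma antipodal_trans : transitive antipodal.
Proof.
move=> y x z /orP[/eqP->//|/eqP xy] /orP[/eqP<-|/eqP yz].
  by rewrite /antipodal xy eqxx orbT.
apply/orP; left; apply/eqP/val_inj.
by rewrite xy yz opprK.
Qed.

Canonical antipodal_equiv :=
  EquivRel antipodal antipodal_refl antipodal_sym antipodal_trans.

End antipodal.

(* RP R n is the n-dimensional projective space RP^n, the space of lines of
   R^(n+1); the index shift makes the type inhabited for every n, as pointed
   types are required by the measure theory *)
Definition RP (R : realType) (n : nat) : Type :=
  {eq_quot (@antipodal_equiv R n.+1)}%qT.

HB.instance Definition _ (R : realType) (n : nat) :=
  Topological.copy (RP R n)
    (quotient_topology {eq_quot (@antipodal_equiv R n.+1)}%qT).
HB.instance Definition _ (R : realType) (n : nat) := EqQuotient.on (RP R n).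
HB.instance Definition _ (R : realType) (n : nat) :=
  Pointed.copy (RP R n) (quotient_topology (RP R n)).
HB.instance Definition _ (R : realType) (n : nat) :=
  Measurable.copy (RP R n) (g_sigma_algebraType (@open (RP R n))).

Lemma pi_antipodal (R : realType) (n : nat) (x y : sphere R n.+1) :
  (\pi_(RP R n) x = \pi_(RP R n) y)%qT <-> antipodal x y.
Proof.
split=> [/eqmodP//|xy]; exact/eqmodP.
Qed.

Section kernel.
Context (R : realType) (n : nat).

(* x and y are represented by unit vectors, and |x.y| does not depend on this
   choice, see absdotE *)
Definition absdot (x y : RP R n) : R :=
  `|dot (\val (repr x : sphere R n.+1)) (\val (repr y : sphere R n.+1))|.

Lemma absdotE (x y : sphere R n.+1) :
  absdot (\pi_(RP R n) x)%qT (\pi_(RP R n) y)%qT = `|dot (\val x) (\val y)|.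
Proof.
have dotC (u v : 'rV[R]_n.+1) : dot u v = dot v u.
  by apply: eq_bigr => i _; rewrite mulrC.
have dotN (u v : 'rV[R]_n.+1) : dot (- u) v = - dot u v.
  by rewrite /dot -sumrN; apply: eq_bigr => i _; rewrite mxE mulNr.
have reprE (z : sphere R n.+1) : antipodal (repr (\pi_(RP R n) z)%qT) z.
  by apply/pi_antipodal; rewrite reprK.
have absN (z : sphere R n.+1) (u : 'rV[R]_n.+1) :
    `|dot (\val (repr (\pi_(RP R n) z)%qT : sphere R n.+1)) u|
    = `|dot (\val z) u|.
  by case/orP: (reprE z) => /eqP-> //; rewrite dotN normrN.
by rewrite /absdot absN dotC absN dotC.
Qed.

End kernel.

Section energy.
Context (R : realType) (n : nat).
Implicit Types (mu : probability (RP R n) R) (K : RP R n -> RP R n -> R).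

Definition energy K mu : R := \int[mu]_y \int[mu]_x K x y.

Definition minimizers K : set (probability (RP R n) R) :=
  [set mu | forall mu', energy K mu <= energy K mu'].

(* p-frame kernel |x.y|^s; powR takes a real exponent, and 0 `^ s = 0 if s > 0 *)
Definition frame (s : R) (x y : RP R n) : R := absdot x y `^ s.

Definition I_ (s : R) mu : R := energy (frame s) mu.

(* the infimum is a minimum: RP R n is compact and frame p continuous *)
Definition e_ (p : R) : R := inf (range (I_ p)).

Definition M_ (p : R) : set (probability (RP R n) R) := minimizers (frame p).

Definition L_ (p q : R) (x y : RP R n) : R :=
  frame p x y - p / q * frame q x y.

Definition purity mu : R := fine ((mu \x mu)%E (@diagonal (RP R n))).

(* the supremum is a maximum: M_ p is weakly compact and nonempty, and purity is
   weakly upper semicontinuous *)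
Definition astar (p : R) : R := sup (purity @` M_ p).

End energy.

Section weak.
Context (R : realType) (n : nat).

Definition integrals (mu : probability (RP R n) R) :
    {ptws continuousType (RP R n) R -> R} :=
  fun f => \int[mu]_x f x.

(* RP R n is compact, so every continuous function on it is bounded *)
Definition weak_probability : Type := initial_topology integrals.

HB.instance Definition _ := Topological.on weak_probability.

End weak.

Definition even_oo : set_system nat := within [set q | ~~ odd q] \oo.

#[global] Instance even_oo_filter : ProperFilter even_oo.
Proof.
apply: Build_ProperFilter_ex => P [N _ NP].
exists N.*2; apply: NP => /=; rewrite ?odd_double//.
by rewrite -addnn leq_addr.
Qed.

(* Main.v *)
(* Comparing the L_(p,q)-minimizer nu_q with an arbitrary minimizer mu of I_p,
   and using I_q(mu) >= A(mu), gives
     0 <= I_p(nu_q) - e(p) <= (p / q) (I_q(nu_q) - a_star(p)),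
   so that I_q(nu_q) >= a_star(p) and both remainders are o(1/q) as soon as
   I_q(nu_q) tends to a_star(p).  On a weak cluster point mu of nu_q, I_p is
   minimal, and I_m(mu) is at least any eventual lower bound c of I_q(nu_q), for
   I_m(nu_q) >= I_q(nu_q) when q >= m and I_m is weakly continuous; as I_m(mu)
   decreases to A(mu), A(mu) >= c.  With c = a_star(p) this gives the claim on
   cluster points; with c = a_star(p) + e it rules out, by weak compactness,
   that I_q(nu_q) >= a_star(p) + e for arbitrarily large q.

   Weak compactness is obtained by coding RP by the Cantor space: along an
   ultrafilter the masses of the cells of the coding converge, and the limit
   masses are realized by a map from [0, 1) to the Cantor space; pushing the
   Lebesgue measure forward to RP gives the limit. *)
Require Import Defs.
From HB Require Import structures.
From mathcomp Require Import all_boot all_order all_algebra.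
From mathcomp Require Import all_classical all_reals all_analysis.
From mathcomp Require Import measurable_realfun ring lra.

Set Implicit Arguments.
Unset Strict Implicit.
Unset Printing Implicit Defensive.

Import Order.TTheory GRing.Theory Num.Theory.
Import numFieldNormedType.Exports.

Local Open Scope classical_set_scope.
Local Open Scope ring_scope.

(** * Topological preliminaries *)

HB.instance Definition _ (R : realType) (d : nat) :=
  PseudoMetric.copy (sphere R d) (set_type (unit_vectors R d)).

Lemma continuous_sum (R : realType) (T : topologicalType) (I : Type)
    (r : seq I) (F : I -> T -> R) :
  (forall i, continuous (F i)) -> continuous (fun x => \sum_(i <- r) F i x).
Proof. by move=> cF; apply: (continuous_big (@add_continuous R)). Qed.

(** A filter on the subtype is pushed forward to [T]; its cluster point in [A] lifts back because
    the subtype carries the induced topology. *)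
Lemma set_type_compact (T : topologicalType) (A : set T) :
  compact A -> compact [set: set_type A].
Proof.
move=> cA F FF _.
have [x [Ax Fx]] : A `&` cluster (fmap set_val F) !=set0.
  apply: cA; suff -> : fmap set_val F A = F setT by exact: filterT.
  by congr F; apply/seteqP; split => // y _; exact: set_valP.
exists (SigSub (mem_set Ax)); split => // B U FB [/= _ [[W oW <-] /= Wx WU]].
have [|_ [[y By <-] Wy]] := Fx (set_val @` B) W _ (open_nbhs_nbhs (conj oW Wx)).
  change (F (set_val @^-1` (set_val @` B))).
  by apply: filterS FB => y By; exists y.
by exists y; split => //; exact: WU.
Qed.

(** * The projective space *)

Section sphere.
Context (R : realType) (n : nat).
Implicit Types (u v : 'rV[R]_n.+1) (x y : RP R n).

Lemma dot_sqr u v : dot (u - v) (u - v) = dot u u + dot v v - 2 * dot u v.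
Proof.
rewrite /dot mulr_sumr -big_split/= -sumrB; apply: eq_bigr => i _.
by rewrite !mxE; ring.
Qed.

Lemma dot_ge0 u : 0 <= dot u u.
Proof. by apply: sumr_ge0 => i _; rewrite -expr2 sqr_ge0. Qed.

Lemma dotN u v : dot u (- v) = - dot u v.
Proof. by rewrite /dot -sumrN; apply: eq_bigr => i _; rewrite mxE mulrN. Qed.

Lemma dotNN u : dot (- u) (- u) = dot u u.
Proof. by apply: eq_bigr => i _; rewrite !mxE mulrNN. Qed.

Lemma dot_eq0 u : dot u u = 0 -> u = 0.
Proof.
move=> /eqP; rewrite psumr_eq0 => [/allP u0|i _]; last first.
  by rewrite -expr2 sqr_ge0.
apply/rowP => i; rewrite mxE; have := u0 i (mem_index_enum i).
by rewrite mulf_eq0 orbb => /eqP.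
Qed.

(** Expand the squared norms of u - v and u + v, both nonnegative. *)
Lemma dot_unit_le1 u v : dot u u = 1 -> dot v v = 1 -> `|dot u v| <= 1.
Proof.
move=> u1 v1; have := dot_ge0 (u - v); have := dot_ge0 (u - - v).
rewrite !dot_sqr dotNN dotN u1 v1 ler_norml; lra.
Qed.

(** Equality in Cauchy-Schwarz: according to the sign of u.v, the squared norm of u + v or of u - v
    vanishes. *)
Lemma dot_unit_eq1 u v : dot u u = 1 -> dot v v = 1 -> `|dot u v| = 1 ->
  u = v \/ u = - v.
Proof.
move=> u1 v1 uv; have [uvp|uvn] := ler0P (dot u v).
- right; apply/eqP; rewrite -subr_eq0; apply/eqP/dot_eq0.
  by rewrite dot_sqr dotNN dotN u1 v1; rewrite ler0_norm// in uv; lra.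
- left; apply/eqP; rewrite -subr_eq0; apply/eqP/dot_eq0.
  by rewrite dot_sqr u1 v1; rewrite gtr0_norm// in uv; lra.
Qed.

Definition unit_repr x : 'rV[R]_n.+1 := \val (repr x : sphere R n.+1).

Lemma unit_reprP x : dot (unit_repr x) (unit_repr x) = 1.
Proof. exact: set_mem (valP (repr x : sphere R n.+1)). Qed.

Lemma absdot_ge0 x y : 0 <= absdot x y.
Proof. exact: normr_ge0. Qed.

Lemma absdot_le1 x y : absdot x y <= 1.
Proof. by apply: dot_unit_le1; exact: unit_reprP. Qed.

Lemma absdotxx x : absdot x x = 1.
Proof. by rewrite /absdot -/(unit_repr x) unit_reprP normr1. Qed.

Lemma absdot_eq1 x y : absdot x y = 1 -> x = y.
Proof.
move=> xy1; rewrite -[x]reprK -[y]reprK; apply/pi_antipodal.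
have [e|e] := dot_unit_eq1 (unit_reprP x) (unit_reprP y) xy1.
- by apply/orP; left; apply/eqP/val_inj.
- by apply/orP; right; apply/eqP.
Qed.

Lemma unit_vectors_compact : compact (unit_vectors R n.+1).
Proof.
apply: bounded_closed_compact.
- exists 1; split; first by rewrite num_real.
  move=> M M1 u u1; rewrite {1}/Num.norm/= mx_normrE; apply/bigmax_leP; split.
    by rewrite (le_trans _ (ltW M1)).
  move=> [i j] _ /=; rewrite ord1 (le_trans _ (ltW M1))//.
  rewrite -(@expr_le1 _ 2)// real_normK ?num_real//.
  move: u1; rewrite /unit_vectors/= /dot (bigD1 j)//= -expr2 => <-.
  by rewrite lerDl sumr_ge0// => k _; rewrite -expr2 sqr_ge0.
- apply: (@preimage_closed _ _ (fun u : 'rV[R]_n.+1 => dot u u) [set 1]).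
    move=> u _; move: u; apply: continuous_sum => i u.
    by have cu := @coord_continuous R 1 n.+1 0 i u; exact: (cvgM cu cu).
  exact: closed_eq.
Qed.

Lemma sphere_compact : compact [set: sphere R n.+1].
Proof. exact: set_type_compact unit_vectors_compact. Qed.

Lemma pi_RP_continuous : continuous (\pi_(RP R n) : sphere R n.+1 -> RP R n)%qT.
Proof. exact: pi_continuous. Qed.

Lemma RP_compact : compact [set: RP R n].
Proof.
have -> : [set: RP R n] = (\pi_(RP R n))%qT @` [set: sphere R n.+1].
  by apply/seteqP; split => // x _; exists (repr x) => //; rewrite reprK.
apply: continuous_compact; last exact: sphere_compact.
exact/continuous_subspaceT/pi_RP_continuous.
Qed.

(* The entries of the matrix of the orthogonal projection onto the line [x]:
   unlike the coordinates of a representative, they are continuous on RP. *)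
Definition RP_entry (i j : 'I_n.+1) x : R := unit_repr x 0 i * unit_repr x 0 j.

(** A product of two coordinates is invariant under the antipode, so a continuous function on the
    sphere descends to the quotient. *)
Lemma RP_entry_continuous i j : continuous (RP_entry i j).
Proof.
apply/quotient_continuous.
have -> : RP_entry i j \o (\pi_(RP R n))%qT =
    fun z : sphere R n.+1 => \val z 0 i * \val z 0 j.
  apply/funext => z; rewrite /RP_entry /unit_repr /=.
  have : antipodal (repr (\pi_(RP R n) z)%qT) z.
    by apply/pi_antipodal; rewrite reprK.
  by case/orP => /eqP ->; rewrite // !mxE mulrNN.
have cz k : continuous (fun z : sphere R n.+1 => \val z 0 k).
  move=> z; apply: (@continuous_comp _ _ _ (\val : sphere R n.+1 -> 'rV[R]_n.+1)
    (fun u : 'rV[R]_n.+1 => u 0 k)); first exact: initial_continuous.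
  exact: coord_continuous.
by move=> z; exact: (cvgM (cz i z) (cz j z)).
Qed.

(** This is the trace of the product of the projections onto the two lines; it expresses [absdot]
    through continuous functions on RP. *)
Lemma absdot_sqr x y :
  absdot x y ^+ 2 = \sum_i \sum_j RP_entry i j x * RP_entry i j y.
Proof.
rewrite /absdot real_normK ?num_real// expr2 /dot mulr_suml.
apply: eq_bigr => i _; rewrite mulr_sumr; apply: eq_bigr => j _.
by rewrite /RP_entry /unit_repr; ring.
Qed.

End sphere.

(** * The frame kernel: continuity, bounds and limit for large exponents *)

Lemma continuous_norm_powR (R : realType) (s : R) : 0 < s ->
  continuous (fun t : R => `|t| `^ s).
Proof.
move=> s0 t; have [->|t0] := eqVneq t 0.
  apply/cvgrPdist_lt => e e0; rewrite normr0 powR0 ?gt_eqF//.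
  near=> u; rewrite sub0r normrN ger0_norm ?powR_ge0//.
  (* At 0, the radius e^(1/s) serves for the tolerance e. *)
  have -> : e = (e `^ s^-1) `^ s.
    by rewrite -powRrM mulVf ?gt_eqF// powRr1// ltW.
  apply: gt0_ltr_powR; rewrite ?nnegrE ?normr_ge0 ?powR_ge0//.
  rewrite -[u]subr0 distrC.
  near: u; apply: (@cvgr_dist_lt _ _ _ _ _ id) => //.
  by rewrite powR_gt0.
apply: (@continuous_comp _ _ _ (fun t : R => `|t|) (@powR R ^~ s)).
  exact: norm_continuous.
apply: differentiable_continuous; apply/derivable1_diffP.
by apply: derivable_powR; rewrite in_itv/= andbT normr_gt0.
Unshelve. all: by end_near. Qed.

Lemma continuous_pairl (S T U : topologicalType) (K : S -> T -> U) (x : S) :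
  continuous (fun xy => K xy.1 xy.2) -> continuous (K x).
Proof.
move=> cK z.
apply: (@continuous_comp _ _ _ (fun z => (x, z)) (fun xy => K xy.1 xy.2)).
  by apply: cvg_pair; [exact: cvg_cst|exact: cvg_id].
exact: cK.
Qed.

Section frame.
Context (R : realType) (n : nat).
Implicit Types (x y : RP R n) (s : R).

Lemma frame_continuous s : 0 < s ->
  continuous (fun xy : RP R n * RP R n => frame s xy.1 xy.2).
Proof.
move=> s0.
(* The kernel is the power s/2 of the square of [absdot], which is a polynomial in the entries of
   the two projections. *)
have -> : (fun xy : RP R n * RP R n => frame s xy.1 xy.2) =
    (fun t : R => `|t| `^ (s / 2)) \o
    (fun xy => \sum_i \sum_j RP_entry i j xy.1 * RP_entry i j xy.2).
  apply/funext => -[x y] /=; rewrite -absdot_sqr ger0_norm ?sqr_ge0//.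
  rewrite -powR_mulrn ?absdot_ge0// -powRrM; congr (_ `^ _).
  by rewrite mulrC divfK.
move=> xy; apply: continuous_comp; last first.
  by apply: continuous_norm_powR; rewrite divr_gt0.
move: xy; apply: continuous_sum => i; apply: continuous_sum => j [x y].
apply: cvgM.
  apply: (@continuous_comp _ _ _ fst) => /=; first exact: cvg_fst.
  exact: RP_entry_continuous.
apply: (@continuous_comp _ _ _ snd) => /=; first exact: cvg_snd.
exact: RP_entry_continuous.
Qed.

Lemma frame_ge0 s x y : 0 <= frame s x y.
Proof. exact: powR_ge0. Qed.

Lemma frame_le1 s x y : 0 < s -> frame s x y <= 1.
Proof.
move=> s0; have -> : 1 = 1 `^ s :> R by rewrite powR1.
by apply: ge0_ler_powR; rewrite ?(ltW s0) ?nnegrE ?absdot_ge0 ?absdot_le1.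
Qed.

Lemma framexx s x : frame s x x = 1.
Proof. by rewrite /frame absdotxx powR1. Qed.

Lemma frame_nat (q : nat) x y : frame q%:R x y = absdot x y ^+ q.
Proof. by rewrite /frame powR_mulrn// absdot_ge0. Qed.

Lemma frame_nincr (m q : nat) x y : (m <= q)%N ->
  frame q%:R x y <= frame m%:R x y.
Proof.
move=> mq; rewrite !frame_nat.
by apply: ler_wiXn2l; rewrite ?absdot_ge0 ?absdot_le1.
Qed.

(** Off the diagonal [absdot] is below 1 and its powers vanish in the limit; this is what ties the
    energies to the purity. *)
Lemma frame_cvg x y : frame q%:R x y @[q --> \oo] --> ((x == y)%:R : R).
Proof.
have [->|xy] := eqVneq x y.
  rewrite (_ : (fun q : nat => frame q%:R y y) = fun=> 1); first exact: cvg_cst.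
  by apply/funext => q; exact: framexx.
rewrite (_ : (fun q : nat => frame q%:R x y) = fun q => absdot x y ^+ q).
  2: by apply/funext => q; exact: frame_nat.
apply: cvg_expr; rewrite ger0_norm ?absdot_ge0// lt_neqAle absdot_le1 andbT.
by apply: contra_neq xy => /absdot_eq1.
Qed.

(** The continuous function [frame 1 x] is 1 at [x] and smaller elsewhere, so the midpoint [c] of
    its values at [x] and [y] separates the two points. *)
Lemma RP_hausdorff : hausdorff_space (RP R n).
Proof.
move=> x y xy; apply: contrapT => /eqP nxy.
have c1 : frame 1 x y < 1.
  rewrite lt_neqAle frame_le1// andbT; apply: contra_neq nxy.
  by rewrite /frame powRr1 ?absdot_ge0// => /absdot_eq1.
have cf := @continuous_pairl _ _ _ _ x (frame_continuous (@ltr01 R)).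
pose c := (1 + frame 1 x y) / 2.
have xc : \forall z \near x, c < frame 1 x z.
  by apply: (@cvgr_gt _ _ _ _ _ _ (cf x)); rewrite framexx /c; lra.
have yc : \forall z \near y, frame 1 x z < c.
  by apply: (@cvgr_lt _ _ _ _ _ _ (cf y)); rewrite /c; lra.
have [z [/= z1 z2]] := xy _ _ xc yc.
by have := lt_trans z1 z2; rewrite ltxx.
Qed.

End frame.

(** * Continuity of the energy *)

Section probability_integral.
Context d (T : measurableType d) (R : realType) (P : probability T R).
Implicit Types (f g : T -> R) (M : R).

Lemma probability_fin A : measurable A -> P A \is a fin_num.
Proof. by move=> mA; exact: fin_num_measure. Qed.

Lemma bounded_integrable f M : measurable_fun setT f ->
  (forall x, `|f x| <= M) -> P.-integrable setT (EFin \o f).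
Proof.
move=> mf fM; apply: measurable_bounded_integrable => //.
- by have := probability_fin (@measurableT _ T); rewrite ge0_fin_numE.
- exists M; split; rewrite ?num_real// => r Mr x _.
  exact: le_trans (fM x) (ltW Mr).
Qed.

Lemma Rintegral_probability_cst M : \int[P]_x M = M.
Proof. by rewrite Rintegral_cst//= probability_setT mulr1. Qed.

Lemma Rintegral_dist_le f g M :
  P.-integrable setT (EFin \o f) -> P.-integrable setT (EFin \o g) ->
  (forall x, `|f x - g x| <= M) -> `|\int[P]_x f x - \int[P]_x g x| <= M.
Proof.
move=> fi gi fgM; rewrite -RintegralB//.
have fgi : P.-integrable setT (EFin \o (f \- g)).
  exact: (integrableB measurableT fi gi).
apply: (le_trans (le_normr_Rintegral measurableT fgi)).
rewrite -[leRHS]Rintegral_probability_cst; apply: le_Rintegral => //.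
- exact: (integrable_norm fgi).
- exact: finite_measure_integrable_cst.
- by move=> x _; exact: fgM.
Qed.

(** Dominated convergence with the constant [M] as majorant. *)
Lemma bounded_Rintegral_cvg (f_ : nat -> T -> R) f M :
  (forall q, measurable_fun setT (f_ q)) -> (forall q x, `|f_ q x| <= M) ->
  (forall x, f_ q x @[q --> \oo] --> f x) ->
  \int[P]_x f_ q x @[q --> \oo] --> \int[P]_x f x.
Proof.
move=> mf fM ff.
have mlim : measurable_fun setT f.
  by apply: (@measurable_fun_cvg _ _ _ _ f_) => // x _; exact: ff.
have fi : P.-integrable setT (EFin \o f).
  apply: (@bounded_integrable _ M) => // x.
  apply: (closed_cvg (fun t => t <= M) (@closed_le _ M) _ _ (cvg_norm (ff x))).
  by apply: nearW => q; exact: fM.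
have /fine_cvgP[_] :
    (\int[P]_x (f_ q x)%:E @[q --> \oo] --> (\int[P]_x f x)%:E)%E.
  rewrite /Rintegral fineK; last exact: integrable_fin_num.
  apply: (@dominated_cvg _ _ _ P setT measurableT (fun q => EFin \o f_ q)
    (EFin \o f) (cst M%:E)) => //.
  - by move=> q; exact/measurable_EFinP.
  - by move=> x _; apply/fine_cvgP; split; [exact: nearW|exact: ff].
  - exact: finite_measure_integrable_cst.
  - by move=> q x _; rewrite /= lee_fin.
by [].
Qed.

End probability_integral.

(** * Continuous functions on projective space as integrands *)

Section borel.
Context (R : realType) (n : nat).
Implicit Types (mu : probability (RP R n) R) (f : RP R n -> R).

Lemma RP_open_measurable (A : set (RP R n)) : open A -> measurable A.
Proof. by move=> oA; exact: sub_sigma_algebra. Qed.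

Lemma RP_closed_measurable (A : set (RP R n)) : closed A -> measurable A.
Proof.
move=> cA; rewrite -[A]setCK; apply: measurableC; apply: RP_open_measurable.
exact: closed_openC.
Qed.

Lemma RP_set1_measurable (x : RP R n) : measurable [set x].
Proof.
apply: RP_closed_measurable; apply: accessible_closed_set1.
exact/hausdorff_accessible/RP_hausdorff.
Qed.

Lemma continuous_RP_measurable f : continuous f -> measurable_fun setT f.
Proof.
move=> /continuousP cf; apply: (measurability _ (RGenOpens.measurableE R)).
move=> _ [_ [a [b ->] <-]]; rewrite setTI; apply: RP_open_measurable.
exact/cf/interval_open.
Qed.

Lemma continuous_RP_bounded f : continuous f -> exists M, forall x, `|f x| <= M.
Proof.
move=> cf.
have /compact_bounded[M [_ fM]] : compact (f @` setT).
  by apply: continuous_compact; [exact: continuous_subspaceT|exact: RP_compact].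
by exists (M + 1) => x; apply: fM; [rewrite ltrDl|exists x].
Qed.

Lemma continuous_RP_integrable mu f : continuous f ->
  mu.-integrable setT (EFin \o f).
Proof.
move=> cf; have [M fM] := continuous_RP_bounded cf.
by apply: (bounded_integrable mu _ fM); exact: continuous_RP_measurable.
Qed.

(** The weak topology is induced by [integrals], and integration of [f] is [integrals] followed by
    evaluation at [f]. *)
Lemma integral_continuous f : continuous f ->
  continuous (fun mu : weak_probability R n => \int[mu]_x f x).
Proof.
move=> cf mu; pose F : continuousType (RP R n) R := mkcts cf.
pose ev (h : {ptws continuousType (RP R n) R -> R}) := h F.
change ((ev \o (@integrals R n : weak_probability R n -> _)) nu
  @[nu --> mu] --> (ev \o (@integrals R n)) mu).
apply: continuous_comp; first exact: initial_continuous.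
exact: (@proj_continuous _ (fun=> R) F).
Qed.

End borel.

Section energy_continuity.
Context (R : realType) (n : nat) (K : RP R n -> RP R n -> R).
Hypothesis cK : continuous (fun xy => K xy.1 xy.2).

Definition potential (mu : probability (RP R n) R) (y : RP R n) : R :=
  \int[mu]_x K x y.

Lemma kernel_continuousl y : continuous (K ^~ y).
Proof.
apply: (@continuous_pairl _ _ _ (fun y x => K x y)) => -[b a].
apply: (@continuous_comp _ _ _ (fun z => (z.2, z.1)) (fun xy => K xy.1 xy.2)).
  exact: swap_continuous.
exact: cK.
Qed.

(** Near a fixed x, both K x' y and K x' y' are within e/2 of K x y; compactness makes the
    neighbourhood of [y] uniform in x. *)
Lemma kernel_equicontinuous e y : 0 < e ->
  \forall y' \near y, forall x, `|K x y - K x y'| <= e.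
Proof.
move=> e0.
have /compact_near_coveringP cRP := @RP_compact R n.
suff H : \forall y' \near y,
    [set: RP R n] `<=` (fun x => `|K x y - K x y'| <= e).
  by move: H; apply: (@filterS _ (nbhs y)) => y' Ky' x; exact: Ky'.
apply: (cRP _ (nbhs y) (fun y' x => `|K x y - K x y'| <= e)) => x _.
have e20 : 0 < e / 2 by rewrite divr_gt0.
have Kx : \forall x' \near x, `|K x y - K x' y| <= e / 2.
  exact: (cvgr_dist_le _ _ (@kernel_continuousl y x)).
have [[/= A B] [xA yB] ABK] :
    \forall x' \near (x, y), `|K x y - K x'.1 x'.2| <= e / 2.
  exact: (cvgr_dist_le _ _ (@cK (x, y))).
exists (A `&` [set x' | `|K x y - K x' y| <= e / 2], B) => /=.
  split => //=; exact: (filterI xA Kx).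
move=> [x' y'] [[/= Ax' Kx'] By'].
have /= := ABK (x', y') (conj Ax' By'); move: Kx'; rewrite !ler_norml; lra.
Qed.

Lemma potential_continuous mu : continuous (potential mu).
Proof.
move=> y; apply/(@cvgrPdist_le _ _ _ (nbhs y)) => e e0.
move: (kernel_equicontinuous y e0); apply: (@filterS _ (nbhs y)) => y' Ky'.
by apply: Rintegral_dist_le => //; apply: continuous_RP_integrable;
  exact: kernel_continuousl.
Qed.

(* The potentials of measures close to [mu] are uniformly close to that of [mu],
   by compactness and equicontinuity. *)
Lemma energy_continuous :
  continuous (fun mu : weak_probability R n => energy K mu).
Proof.
move=> mu; apply/(@cvgrPdist_le _ _ _ (nbhs mu)) => e e0.
have e40 : 0 < e / 4 by rewrite divr_gt0.
have /compact_near_coveringP cRP := @RP_compact R n.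
(* The three quarters pay for moving from y' to y under [mu], from [mu] to [nu] at y, and from y
   back to y' under [nu]. *)
have unif : \forall nu \near mu, [set: RP R n] `<=`
    (fun y => `|potential mu y - potential nu y| <= e / 4 *+ 3).
  apply: (cRP _ (nbhs mu)
    (fun nu y => `|potential mu y - potential nu y| <= e / 4 *+ 3)) => y _.
  have Ky := kernel_equicontinuous y e40.
  have Kmu : \forall nu \near mu, `|potential mu y - potential nu y| <= e / 4.
    have := @integral_continuous _ _ _ (@kernel_continuousl y) mu.
    by move/cvgr_dist_le; apply.
  exists ([set y' | forall x, `|K x y - K x y'| <= e / 4],
    [set nu | `|potential mu y - potential nu y| <= e / 4]); first by split.
  move=> [y' nu] [/= Ky' munu].
  have dist (la : probability (RP R n) R) :
      `|potential la y - potential la y'| <= e / 4.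
    by apply: Rintegral_dist_le => //; apply: continuous_RP_integrable;
      exact: kernel_continuousl.
  move: (dist mu) (dist nu) munu; rewrite !ler_norml; lra.
have Umu : nbhs mu [set nu : weak_probability R n |
    `|energy K mu - \int[nu]_y potential mu y| <= e / 4].
  have := @integral_continuous _ _ _ (@potential_continuous mu) mu.
  by move/cvgr_dist_le; apply.
(* The integral of [potential mu] against [nu] is the intermediate term: only the outer measure
   changes in [d1], only the potential in [d2]. *)
near=> nu.
have d1 : `|energy K mu - \int[nu]_y potential mu y| <= e / 4 by near: nu.
have d2 : `|\int[nu]_y potential mu y - energy K nu| <= e / 4 *+ 3.
  apply: Rintegral_dist_le.
  - exact/continuous_RP_integrable/potential_continuous.
  - exact/continuous_RP_integrable/potential_continuous.
  - by move=> y; have := near unif nu; apply.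
by move: d1 d2; rewrite !ler_norml; lra.
Unshelve. all: by end_near. Qed.

End energy_continuity.

(** * The purity as the limit of the energies *)

(** The shift discards the exponent 0, since the facts on [frame] used below ask for a positive
    exponent. *)
Lemma cvg_seqS (R : realType) (u : nat -> R) (l : R) :
  (u q @[q --> \oo] --> l) <-> (u q.+1 @[q --> \oo] --> l).
Proof. by rewrite cvg_shiftS. Qed.

Section frame_energy.
Context (R : realType) (n : nat).
Implicit Types (mu : probability (RP R n) R) (s : R).

Lemma frame_continuousl s (y : RP R n) : 0 < s -> continuous ((frame s)^~ y).
Proof. by move=> s0; apply: kernel_continuousl; exact: frame_continuous. Qed.

Lemma frame_norm_le1 s (x y : RP R n) : 0 < s -> `|frame s x y| <= 1.
Proof. by move=> s0; rewrite ger0_norm ?frame_ge0 ?frame_le1. Qed.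

Lemma frame_integrable mu s y : 0 < s ->
  mu.-integrable setT (EFin \o (frame s)^~ y).
Proof. by move=> s0; exact/continuous_RP_integrable/frame_continuousl. Qed.

Lemma potential_frame_continuous mu s : 0 < s ->
  continuous (potential (@frame R n s) mu).
Proof. by move=> s0; apply: potential_continuous; exact: frame_continuous. Qed.

Lemma potential_frame_integrable mu s : 0 < s ->
  mu.-integrable setT (EFin \o potential (@frame R n s) mu).
Proof.
by move=> s0; exact/continuous_RP_integrable/potential_frame_continuous.
Qed.

Lemma I_continuous s : 0 < s ->
  continuous (I_ s : weak_probability R n -> R).
Proof. by move=> s0; apply: energy_continuous; exact: frame_continuous. Qed.

Lemma potential_frame_ge0 mu s y : 0 <= potential (@frame R n s) mu y.
Proof. by apply: Rintegral_ge0 => x _; exact: frame_ge0. Qed.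

Lemma potential_frame_le1 mu s y : 0 < s -> potential (@frame R n s) mu y <= 1.
Proof.
move=> s0; rewrite -[leRHS](Rintegral_probability_cst mu).
apply: le_Rintegral => //.
- exact: frame_integrable.
- exact: finite_measure_integrable_cst.
- by move=> x _; exact: frame_le1.
Qed.

Lemma I_ge0 mu s : 0 <= I_ s mu.
Proof. by apply: Rintegral_ge0 => y _; exact: potential_frame_ge0. Qed.

Lemma I_le1 mu s : 0 < s -> I_ s mu <= 1.
Proof.
move=> s0; rewrite -[leRHS](Rintegral_probability_cst mu).
apply: le_Rintegral => //.
- exact: potential_frame_integrable.
- exact: finite_measure_integrable_cst.
- by move=> x _; exact: potential_frame_le1.
Qed.

Lemma I_nincr mu (m q : nat) : (0 < m)%N -> (m <= q)%N ->
  I_ q%:R mu <= I_ m%:R mu.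
Proof.
move=> m0 mq; have q0 := leq_trans m0 mq.
apply: le_Rintegral => //.
- by apply: potential_frame_integrable; rewrite ltr0n.
- by apply: potential_frame_integrable; rewrite ltr0n.
move=> y _; apply: le_Rintegral => //.
- by apply: frame_integrable; rewrite ltr0n.
- by apply: frame_integrable; rewrite ltr0n.
- by move=> x _; exact: frame_nincr.
Qed.

Lemma potential_frame_cvg mu y :
  potential (@frame R n q.+1%:R) mu y @[q --> \oo] --> fine (mu [set y]).
Proof.
have -> : fine (mu [set y]) = \int[mu]_x (x == y)%:R.
  rewrite /Rintegral; congr fine.
  have := integral_indic mu measurableT (RP_set1_measurable y).
  rewrite setIT => <-.
  by apply: eq_integral => x _; rewrite indicE in_set1.
apply: (@bounded_Rintegral_cvg _ _ _ mu
  (fun q x => frame q.+1%:R x y) _ 1) => [q|q x|x].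
- by apply: continuous_RP_measurable; apply: frame_continuousl; rewrite ltr0n.
- by apply: frame_norm_le1; rewrite ltr0n.
- exact/(cvg_seqS (fun q : nat => frame q%:R x y))/frame_cvg.
Qed.

(** The product measure integrates the masses of sections, and the section of the diagonal at a
    point is that point. *)
Lemma purityE mu : purity mu = \int[mu]_y fine (mu [set y]).
Proof.
rewrite /purity /product_measure1 /Rintegral; congr fine.
apply: eq_integral => x _ /=.
rewrite fineK ?fin_num_measure//; last exact: RP_set1_measurable.
by congr (mu _); apply/seteqP; split => y; rewrite /xsection/= inE /diagonal/=.
Qed.

(** Dominated convergence a second time: the potentials, bounded by 1, tend to the point masses. *)
Lemma I_cvg_purity mu : I_ q%:R mu @[q --> \oo] --> purity mu.
Proof.
apply/(cvg_seqS (fun q : nat => I_ q%:R mu)); rewrite purityE.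
apply: (@bounded_Rintegral_cvg _ _ _ mu
  (fun q => potential (@frame R n q.+1%:R) mu) _ 1) => [q|q x|x].
- apply: continuous_RP_measurable; apply: potential_frame_continuous.
  by rewrite ltr0n.
- by rewrite ger0_norm ?potential_frame_ge0 ?potential_frame_le1 ?ltr0n.
- exact: potential_frame_cvg.
Qed.

Lemma purity_le_I mu (m : nat) : (0 < m)%N -> purity mu <= I_ m%:R mu.
Proof.
move=> m0; apply: (closed_cvg (fun t => t <= I_ m%:R mu) (@closed_le _ _) _ _
  (@I_cvg_purity mu)).
by near=> q; apply: I_nincr => //; near: q; exact: nbhs_infty_ge.
Unshelve. all: by end_near. Qed.

Lemma le_purity mu a : (forall m : nat, (0 < m)%N -> a <= I_ m%:R mu) ->
  a <= purity mu.
Proof.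
move=> aI; apply: (closed_cvg (fun t => a <= t) (@closed_ge _ _) _ _
  (@I_cvg_purity mu)).
by near=> q; apply: aI; near: q; exact: nbhs_infty_gt.
Unshelve. all: by end_near. Qed.

Lemma purity_le1 mu : purity mu <= 1.
Proof. by apply: le_trans (purity_le_I mu (ltn0Sn 0)) _; rewrite I_le1. Qed.

End frame_energy.

(** * Weak compactness *)

Section binary_words.
Implicit Types (z : cantor_space) (w : seq bool) (k : nat).

(* The first [k] bits of [z], the last one first. *)
Definition revprefix z k : seq bool := rev (mkseq z k).

Lemma revprefixS z k : revprefix z k.+1 = z k :: revprefix z k.
Proof. by rewrite /revprefix mkseqS rev_rcons. Qed.

Lemma size_revprefix z k : size (revprefix z k) = k.
Proof. by rewrite size_rev size_mkseq. Qed.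

(** With reversed words, refining a cylinder is putting a bit in front of [w]. *)
Definition cylinder w : set cantor_space := [set z | revprefix z (size w) = w].

(** A sample point of the cylinder: the bits of [w] continued by [false]. *)
Definition extend w : cantor_space := fun i => nth false (rev w) i.

Lemma extend_cylinder w : cylinder w (extend w).
Proof.
rewrite /cylinder /= /revprefix /extend -[X in mkseq _ X]size_rev mkseq_nth.
exact: revK.
Qed.

Lemma cylinder_split w z : cylinder w z -> cylinder (z (size w) :: w) z.
Proof. by rewrite /cylinder/= revprefixS => ->. Qed.

Lemma revprefix_eqP z z' k :
  revprefix z k = revprefix z' k <-> forall i, (i < k)%N -> z i = z' i.
Proof.
split=> [/(congr1 rev)|zz']; last first.
  rewrite /revprefix /mkseq; congr rev; apply: (eq_in_map _ _ _).1 => i.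
  by rewrite mem_iota add0n => /andP[_]; exact: zz'.
rewrite /revprefix !revK => e i ik.
by rewrite -(nth_mkseq false z ik) e nth_mkseq.
Qed.

Lemma revprefix_near z k : \forall z' \near z, revprefix z' k = revprefix z k.
Proof.
elim: k => [|k IH]; first by near=> z'.
have zk : \forall z' \near z, z' k = z k.
  have /(_ z [set z k]) := @proj_continuous nat (fun=> bool) k.
  by apply; exact: discrete_set1.
by near=> z'; rewrite !revprefixS; congr (_ :: _); near: z'.
Unshelve. all: by end_near. Qed.

Lemma cylinder_closed w : closed (cylinder w).
Proof.
move=> z zw; have [z' [<- z'z]] := zw _ (revprefix_near z (size w)).
by rewrite /cylinder/= -z'z size_revprefix.
Qed.

(** The filter generated by the cylinders around [z] converges to [z] in each coordinate, hence in
    the product topology. *)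
Lemma nbhs_cylinder z (U : set cantor_space) : nbhs z U ->
  exists k, cylinder (revprefix z k) `<=` U.
Proof.
pose G := filter_from setT (fun k => cylinder (revprefix z k)).
have GF : Filter G.
  apply: filter_from_filter; first by exists 0%N.
  move=> i j _ _; exists (maxn i j) => // z'.
  rewrite /cylinder /= !size_revprefix => /revprefix_eqP zz'.
  by split; apply/revprefix_eqP => l li; apply: zz'; rewrite leq_max li ?orbT.
suff Gz : G --> z by move=> /Gz[k _ kU]; exists k.
apply/cvg_sup => i U' [/= _ [[W oW <-] /= Wz WU']].
exists i.+1 => // z'; rewrite /cylinder /= size_revprefix => /revprefix_eqP zz'.
by apply: WU'; rewrite /= zz'.
Qed.

(** Uniform continuity on a compact space, closeness being agreement of the first [k] bits. *)
Lemma continuous_cantor_osc (R : realType) (h : cantor_space -> R) (e : R) :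
  continuous h -> 0 < e ->
  exists k, forall z z', revprefix z k = revprefix z' k -> `|h z - h z'| <= e.
Proof.
move=> ch e0; have e20 : 0 < e / 2 by rewrite divr_gt0.
have /compact_near_coveringP cC := cantor_space_compact.
have [N _ HN] : \forall k \near \oo, [set: cantor_space] `<=`
    (fun z => forall z', revprefix z k = revprefix z' k -> `|h z - h z'| <= e).
  apply: (cC _ \oo (fun k z => forall z', revprefix z k = revprefix z' k ->
    `|h z - h z'| <= e)) => z _.
  have [k kU] := nbhs_cylinder (cvgr_dist_le _ _ (@ch z) _ e20).
  exists ([set z1 | revprefix z1 k = revprefix z k], [set k' | (k <= k')%N]).
    by split; [exact: revprefix_near|exact: nbhs_infty_ge].
  move=> [z1 k'] /= [z1z kk'] z2 z12.
  have := kU z1; have := kU z2; rewrite /cylinder /= !size_revprefix.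
  have z21 : revprefix z2 k = revprefix z k.
    rewrite -z1z; apply/revprefix_eqP => i ik; apply/esym.
    by move/revprefix_eqP: z12; apply; exact: leq_trans kk'.
  by move=> /(_ z21) + /(_ z1z); rewrite !ler_norml; lra.
by exists N => z z' zz'; exact: (HN N (leqnn N) z I z' zz').
Qed.

End binary_words.

(** * Measurable cells coded by binary words *)

Section cell_word.
Context d (T : measurableType d) (g : cantor_space -> T).
Hypothesis g_surj : forall x, exists z, g z = x.
Hypothesis g_cylinder : forall w, measurable (g @` cylinder w).

(* The code of a point is its lexicographically least preimage by [g], so that
   the cells are Boolean combinations of images of cylinders. *)
Fixpoint cell_word (x : T) (k : nat) : seq bool :=
  if k is k'.+1 then
    let w := cell_word x k' in (x \notin g @` cylinder (false :: w)) :: w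
  else [::].

Lemma size_cell_word x k : size (cell_word x k) = k.
Proof. by elim: k => //= k ->. Qed.

(** If no preimage in the current cylinder continues with [false], the one at hand continues with
    [true]. *)
Lemma cell_wordP x k : (g @` cylinder (cell_word x k)) x.
Proof.
elim: k => [|k [z zw gz]].
  by have [z gz] := g_surj x; exists z.
set w := false :: cell_word x k; rewrite /= -/w.
case: (boolP (x \in g @` cylinder w)) => [/set_mem//|/negP xf].
 exists z => //.
have := cylinder_split zw; case: (z _) => // zf.
by exfalso; apply: xf; apply/mem_set; exists z.
Qed.

Lemma cell_word_measurable k w : measurable [set x | cell_word x k = w].
Proof.
elim: k w => [|k IH] w.
  have [->|w0] := eqVneq w [::].
    by rewrite (_ : [set _ | _] = setT)//; apply/seteqP.
  rewrite (_ : [set _ | _] = set0)//; apply/seteqP; split => // x /= /esym/eqP.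
  by rewrite (negbTE w0).
case: w => [|b w].
  by rewrite (_ : [set _ | _] = set0)//; apply/seteqP; split.
rewrite (_ : [set _ | _] = [set x | cell_word x k = w] `&`
  if b then ~` (g @` cylinder (false :: w)) else g @` cylinder (false :: w)).
  by apply: measurableI => //; case: b => //; exact: measurableC.
apply/seteqP; split => [x /= [<- <-]|x /= [->]].
  by split => //; case: (boolP (_ \in _)) => [/set_mem//|/negP xf /mem_set].
case: b => [xf|xf]; congr (_ :: _); first by apply/negP => /set_mem.
exact/negbF/mem_set.
Qed.

End cell_word.

(** * Nested partitions of the unit interval with prescribed lengths *)

Section nested_intervals.
Context (R : realType) (m : seq bool -> R).
Hypothesis m_ge0 : forall w, 0 <= m w.
Hypothesis m_nil : m [::] = 1.
Hypothesis m_split : forall w, m w = m (false :: w) + m (true :: w).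

(* The half-open intervals of lengths [m w], starting at [left_end w], form
   refining partitions of [0, 1). *)
Fixpoint left_end (w : seq bool) : R :=
  if w is b :: w' then left_end w' + (if b then m (false :: w') else 0) else 0.

Fixpoint interval_word (u : R) (k : nat) : seq bool :=
  if k is k'.+1 then
    let w := interval_word u k' in (left_end w + m (false :: w) <= u) :: w
  else [::].

Definition interval_path (u : R) : cantor_space := fun k =>
  let w := interval_word u k in left_end w + m (false :: w) <= u.

Lemma revprefix_path u k : revprefix (interval_path u) k = interval_word u k.
Proof. by elim: k => // k IH; rewrite revprefixS IH. Qed.

Lemma size_interval_word u k : size (interval_word u k) = k.
Proof. by rewrite -revprefix_path size_revprefix. Qed.

Lemma left_end_ge0 w : 0 <= left_end w.
Proof. by elim: w => //= b w IH; rewrite addr_ge0//; case: b. Qed.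

Lemma right_end_le1 w : left_end w + m w <= 1.
Proof.
elim: w => [|b w IH] /=; first by rewrite m_nil add0r.
apply: le_trans IH; rewrite (m_split w) -addrA lerD2l.
by have := m_ge0 (false :: w); have := m_ge0 (true :: w); case: b; lra.
Qed.

(** By [m_split] the interval of a word is cut into those of its two extensions, and the comparison
    made by [interval_word] tells on which side of the cut [u] lies. *)
Lemma interval_wordP u w : 0 <= u < 1 ->
  (interval_word u (size w) = w) <-> (left_end w <= u < left_end w + m w).
Proof.
move=> u01; elim: w => [|b w IH] /=; first by rewrite m_nil add0r.
have m0 := m_ge0 (false :: w); have m1 := m_ge0 (true :: w).
have mw := m_split w.
split=> [[]|].
  move=> + e; rewrite e; move/IH: e => /andP[e1 e2]; case: b => [h|/negbT].
    by rewrite h/=; lra.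
  by rewrite -ltNge addr0 => ->; rewrite e1.
case: b => /andP[h1 h2].
  have e : interval_word u (size w) = w by apply/IH; lra.
  by rewrite e h1.
have e : interval_word u (size w) = w by apply/IH; lra.
by rewrite e addr0 in h2 *; congr (_ :: _); apply/negbTE; rewrite -ltNge.
Qed.

Lemma interval_word_measurable k w : measurable [set u | interval_word u k = w].
Proof.
elim: k w => [|k IH] w.
  have [->|w0] := eqVneq w [::].
    by rewrite (_ : [set _ | _] = setT)//; apply/seteqP.
  rewrite (_ : [set _ | _] = set0)//; apply/seteqP; split => // x /= /esym/eqP.
  by rewrite (negbTE w0).
case: w => [|b w].
  by rewrite (_ : [set _ | _] = set0)//; apply/seteqP; split.
pose H := [set u | left_end w + m (false :: w) <= u].
have mH : measurable H.
  rewrite (_ : H = `[left_end w + m (false :: w), +oo[%classic) //.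
  by apply/seteqP; split => u; rewrite /H /= in_itv /= andbT.
rewrite (_ : [set _ | _] = [set u | interval_word u k = w] `&`
  if b then H else ~` H).
  by apply: measurableI => //; case: b => //; exact: measurableC.
apply/seteqP; split => [x /= [<- ->]|x /= [->]].
  by split => //; rewrite /H; case: (boolP (_ <= x)) => [//|/negP].
by case: b => xf; congr (_ :: _) => //; apply/negbTE/negP.
Qed.

End nested_intervals.

(** * Integrals of functions of a word of fixed length *)

Section finite_range.
Context d (T : measurableType d) (R : realType) (P : probability T R).
Context (W : T -> seq bool) (k : nat) (h : seq bool -> R).
Hypothesis size_W : forall t, size (W t) = k.
Hypothesis measurable_W : forall w, measurable [set t | W t = w].

Let indic_W t :
  h (W t) = \sum_(w : k.-tuple bool) h w * \1_[set t | W t = w] t.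
Proof.
have Wk : size (W t) == k by rewrite size_W.
rewrite (bigD1 (Tuple Wk))//= indicE mem_set// mulr1 big1 ?addr0// => w wW.
rewrite indicE memNset ?mulr0// => /= Ww.
by move/eqP: wW; apply; exact: val_inj.
Qed.

Let indic_integrable (w : seq bool) :
  P.-integrable setT (fun t => (h w * \1_[set t | W t = w] t)%:E).
Proof.
apply: (bounded_integrable P (M := `|h w|)) => [|t].
  exact/measurable_funM/measurable_indic.
by rewrite normrM ler_piMr// indicE; case: (_ \in _); rewrite ?normr1 ?normr0.
Qed.

Lemma finite_range_integrable : P.-integrable setT (EFin \o (h \o W)).
Proof.
rewrite (_ : EFin \o _ = fun t => (\sum_(w : k.-tuple bool)
    (h w * \1_[set t | W t = w] t)%:E)%E).
  by apply: integrable_sum => // w _; exact: indic_integrable.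
by apply/funext => t; rewrite /= indic_W sumEFin.
Qed.

Lemma finite_range_Rintegral :
  \int[P]_t h (W t) =
  \sum_(w : k.-tuple bool) h w * fine (P [set t | W t = w]).
Proof.
rewrite /Rintegral; under eq_integral do rewrite indic_W -sumEFin.
rewrite integral_sum//.
rewrite [X in fine X](_ : _ = (\sum_(w : k.-tuple bool)
  h w * fine (P [set t | W t = w]))%:E)//.
rewrite -sumEFin; apply: eq_bigr => w _.
under eq_integral do rewrite EFinM.
rewrite integralZl//; last first.
  apply: (bounded_integrable P (M := 1)) => [|t]; first exact: measurable_indic.
  by rewrite indicE; case: (_ \in _); rewrite ?normr1 ?normr0.
by rewrite integral_indic// setIT EFinM fineK// fin_num_measure.
Qed.

(** It serves twice: for a measure on RP with the code of a point, and for Lebesgue measure with the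
    word of a number. *)
Lemma finite_range_Rintegral_dist (f : T -> R) (e : R) :
  P.-integrable setT (EFin \o f) -> (forall t, `|f t - h (W t)| <= e) ->
  `|\int[P]_t f t -
    \sum_(w : k.-tuple bool) h w * fine (P [set t | W t = w])| <= e.
Proof.
move=> fi fh; rewrite -finite_range_Rintegral.
exact: Rintegral_dist_le fi finite_range_integrable fh.
Qed.

End finite_range.

(** For a neighbourhood of a cluster point, the ultrafilter contains its preimage or the complement
    of it; the latter contradicts clustering. *)
Lemma ultra_cvg_compact (T : Type) (V : topologicalType) (F : set_system T)
    (f : T -> V) (K : set V) : UltraFilter F -> compact K ->
  (forall t, K (f t)) -> exists2 l, K l & f @ F --> l.
Proof.
move=> FU cK Kf; have [l [Kl fl]] : K `&` cluster (f @ F) !=set0.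
  apply: cK; suff -> : (f @ F) K = F setT by exact: filterT.
  by congr F; apply/seteqP; split => // t _; exact: Kf.
exists l => // U /= lU.
have [//|Fc] := in_ultra_setVsetC (f @^-1` U) FU.
have [|v [nUv Uv]] := fl (~` U) U _ lU; first exact: Fc.
by [].
Qed.

(** * Lebesgue measure on the unit interval *)

Section unit_interval_probability.
Context (R : realType).

Definition unit_lebesgue :=
  mrestr lebesgue_measure (@measurable_itv R `[0, 1[).

HB.instance Definition _ :=
  Measure.copy unit_lebesgue
    (mrestr lebesgue_measure (@measurable_itv R `[0, 1[)).

Lemma unit_lebesgueE A :
  unit_lebesgue A = lebesgue_measure (A `&` `[0, 1[%classic).
Proof. by []. Qed.

Let unit_lebesgue_setT : unit_lebesgue setT = 1%E.
Proof.
rewrite unit_lebesgueE setTI lebesgue_measure_itv/=.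
by rewrite lte_fin ltr01 oppr0 adde0.
Qed.

HB.instance Definition _ :=
  Measure_isProbability.Build _ _ _ unit_lebesgue unit_lebesgue_setT.

End unit_interval_probability.

Lemma unit_lebesgue_interval_word (R : realType) (m : seq bool -> R) w :
  (forall w, 0 <= m w) -> m [::] = 1 ->
  (forall w, m w = m (false :: w) + m (true :: w)) ->
  unit_lebesgue [set u : R | interval_word m u (size w) = w] = (m w)%:E.
Proof.
move=> m0 m1 ms; rewrite unit_lebesgueE.
have -> : [set u | interval_word m u (size w) = w] `&` `[0, 1[%classic =
    `[left_end m w, left_end m w + m w[%classic.
  apply/seteqP; split => u /=; rewrite !in_itv/=.
    by move=> [e u01]; apply/(interval_wordP m0 m1 ms).
  move=> uw; have u01 : 0 <= u < 1.
    move/andP: uw => [u1 u2]; rewrite (le_trans (left_end_ge0 m0 w) u1)/=.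
    exact: lt_le_trans u2 (right_end_le1 m0 m1 ms w).
  by split => //; exact/(interval_wordP m0 m1 ms).
(* The length formula tests whether the interval is nonempty, so the mass 0 is a case of its own. *)
rewrite lebesgue_measure_itv/= lte_fin ltrDl lt_neqAle m0 andbT eq_sym.
have [->//|mw0] := eqVneq (m w) 0.
by rewrite -EFinB addrAC subrr add0r.
Qed.

(** [cantor_surj] asks for a space that is both pointed and pseudometric. *)
HB.instance Definition _ (R : realType) (n : nat) := Pointed.on (sphere R n.+1).

(** * Projective space as a continuous image of the Cantor space *)

Section cantor_parametrization.
Context (R : realType) (n : nat).

Lemma sphere_hausdorff : hausdorff_space (sphere R n.+1).
Proof.
move=> x y xy; apply: val_inj.
apply: (@norm_hausdorff _ 'rV[R]_n.+1) => A B xA yB.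
have vc : continuous (\val : sphere R n.+1 -> 'rV[R]_n.+1).
  exact: initial_continuous.
by have [z [Az Bz]] := xy _ _ (vc x _ xA) (vc y _ yB); exists (\val z).
Qed.

(** The sphere, compact and metric, is an image of the Cantor space; the quotient map does the
    rest. *)
Lemma RP_cantor_surj : exists g : cantor_space -> RP R n,
  continuous g /\ forall x, exists z, g z = x.
Proof.
have [f cf] := @cantor_surj R (sphere R n.+1) (@sphere_compact R n)
  sphere_hausdorff.
exists (\pi_(RP R n) \o f)%qT; split.
  by move=> z; apply: continuous_comp; [exact: cf|exact: pi_RP_continuous].
move=> x; have [z _ fz] := @surj _ _ _ _ f (repr x) I.
by exists z; rewrite /= fz reprK.
Qed.

End cantor_parametrization.

Section weak_compactness.
Context (R : realType) (n : nat).
Context (g : cantor_space -> RP R n).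
Hypothesis cg : continuous g.
Hypothesis g_surj : forall x, exists z, g z = x.

Lemma image_cylinder_measurable w : measurable (g @` cylinder w).
Proof.
apply: RP_closed_measurable; apply: compact_closed; first exact: RP_hausdorff.
apply: continuous_compact; first exact: continuous_subspaceT.
apply: subclosed_compact; first exact: cylinder_closed.
- exact: cantor_space_compact.
- by [].
Qed.

Lemma path_measurable (m : seq bool -> R) :
  measurable_fun setT (g \o interval_path m : R -> RP R n).
Proof.
apply: (@measurability _ _ _ _ _ _ (@open (RP R n))) => [//|_] [B oB <-].
rewrite setTI.
(* [interval_path] need not be continuous, but the preimage of [B] under [g] is a union of
   cylinders, there are countably many words, and each cylinder has a measurable preimage. *)
pose F (w : seq bool) := if `[< cylinder w `<=` g @^-1` B >]
  then [set u | interval_word m u (size w) = w] else set0.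
rewrite (_ : _ @^-1` _ = \bigcup_w F w).
  apply: countable_bigcupT_measurable => [|w]; first exact: countableP.
  by rewrite /F; case: ifP => // _; exact: interval_word_measurable.
apply/seteqP; split => [u Bu|u [w _]].
  have : nbhs (interval_path m u) (g @^-1` B).
    by apply: cg; exact: open_nbhs_nbhs.
  move=> /nbhs_cylinder[k kB]; exists (revprefix (interval_path m u) k) => //.
  rewrite /F; case: asboolP => // _ /=.
  by rewrite -revprefix_path !size_revprefix.
rewrite /F; case: asboolP => // wB /= uw.
by apply: wB; rewrite /cylinder/= revprefix_path.
Qed.

Lemma cvg_weak (F : set_system (weak_probability R n))
    (mu : weak_probability R n) :
  Filter F ->
  (forall f : RP R n -> R, continuous f ->
     \int[nu]_x f x @[nu --> F] --> \int[mu]_x f x) ->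
  F --> mu.
Proof.
move=> FF Ff.
have H : (@integrals R n) @ F --> (@integrals R n mu).
  apply/cvg_sup => f U [/= _ [[W oW <-] /= Wmu WU]].
  apply: filterS WU _.
  by apply: (Ff f (@cts_fun _ _ f)); exact: open_nbhs_nbhs.
move=> U [/= _ [[W oW <-] /= Wmu WU]]; apply: filterS WU _.
by apply: H; exact: open_nbhs_nbhs.
Qed.

End weak_compactness.

(** * Limits of probabilities along ultrafilters *)

Section weak_compactness.
Context (R : realType) (n : nat).
Local Notation weakP := (weak_probability R n).

Lemma weak_probability_compact : compact [set: weakP].
Proof.
have [g [cg g_surj]] := RP_cantor_surj R n.
have mg := image_cylinder_measurable cg.
have mcode k w := cell_word_measurable mg k w.
rewrite compact_ultra => F FU _.
pose cell w : set (RP R n) := [set x | cell_word g x (size w) = w].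
have mcell w : measurable (cell w) by exact: mcode.
have fcell (nu : weakP) w : nu (cell w) \is a fin_num by exact: fin_num_measure.
pose mass (w : seq bool) (nu : weakP) : R :=
  fine ((nu : probability _ _) (cell w)).
have mass01 w nu : mass w nu \in `[0, 1].
  by rewrite in_itv/= fine_ge0//= -lee_fin fineK// probability_le1.
have /choice[m mP] w : exists l : R, l \in `[0, 1] /\ mass w @ F --> l.
  have [l l01 Fl] := ultra_cvg_compact FU (@segment_compact R 0 1) (mass01 w).
  by exists l.
have m0 w : 0 <= m w by have [] := mP w; rewrite in_itv/= => /andP[].
have m1 : m [::] = 1.
  have [_ h] := mP [::]; apply: (cvg_unique _ h); first exact: norm_hausdorff.
  rewrite (_ : mass [::] = cst 1); first exact: cvg_cst.
  apply/funext => nu; rewrite /mass (_ : cell [::] = setT) ?probability_setT//.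
  by apply/seteqP; split.
(* Additivity holds for the cell masses of each measure and passes to the limit. *)
have ms w : m w = m (false :: w) + m (true :: w).
  have [_ h] := mP w; apply: (cvg_unique _ h); first exact: norm_hausdorff.
  rewrite (_ : mass w = mass (false :: w) \+ mass (true :: w)).
    by apply: cvgD; [have [] := mP (false :: w)|have [] := mP (true :: w)].
  apply/funext => nu; rewrite /mass/= -fineD// -measureU//.
    congr (fine (nu _)); apply/seteqP; split => [x xw|x [[]//|[]//]].
    by move: (xw); rewrite /cell /= => ->; case: (_ \notin _); [right|left].
  by apply/seteqP; split => // x [[+ _] [+ _]] => -> .
have mpath := path_measurable cg m.
pose G : {mfun measurableTypeR R >-> RP R n} := HB.pack (g \o interval_path m)
  (isMeasurableFun.Build _ _ (measurableTypeR R) (RP R n)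
    (g \o interval_path m) mpath).
(* [mu] need not give each cell its limit mass, as a path need not be the least preimage of its
   image; it is enough that the words of the paths have masses [m]. *)
pose mu : probability (RP R n) R := distribution (@unit_lebesgue R) G.
exists (mu : weakP); split => //; apply: cvg_weak => f cf.
apply/cvgrPdist_le => e e0; have e30 : 0 < e / 3 by rewrite divr_gt0.
have cfg : continuous (f \o g).
  by move=> z; apply: continuous_comp; [exact: cg|exact: cf].
have [k kosc] := continuous_cantor_osc cfg e30.
(* Up to e/3, f o g depends on [k] bits only, through [h]. Both integrals are thus e/3-close to
   finite sums, which differ by e/3 at most along [F]. *)
pose h w := f (g (extend w)).
have hE z : `|f (g z) - h (revprefix z k)| <= e / 3.
  apply: kosc; have := @extend_cylinder (revprefix z k).
  by rewrite /cylinder/= size_revprefix.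
have mu_sum : `|\int[mu]_x f x - \sum_(w : k.-tuple bool) h w * m w| <= e / 3.
  have [M fM] := continuous_RP_bounded cf.
  have mf := continuous_RP_measurable cf.
  have fGi : (@unit_lebesgue R).-integrable setT (EFin \o (f \o G)).
    apply: (bounded_integrable _ (M := M)) => [|u]; last exact: fM.
    exact: measurableT_comp.
  have -> : \int[mu]_x f x = \int[@unit_lebesgue R]_u f (G u).
    congr fine; apply: integral_distribution => //.
    exact/measurable_EFinP.
  rewrite (eq_bigr (fun w : k.-tuple bool =>
      h w * fine (unit_lebesgue [set u | interval_word m u k = w]))).
    apply: finite_range_Rintegral_dist fGi _ => [u|w|u].
    - exact: size_interval_word.
    - exact: interval_word_measurable.
    - by rewrite -revprefix_path; exact: hE.
  move=> w _; have := unit_lebesgue_interval_word w m0 m1 ms.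
  by rewrite size_tuple => ->.
have nu_sum (nu : weakP) :
    `|\int[nu]_x f x - \sum_(w : k.-tuple bool) h w * mass w nu| <= e / 3.
  rewrite (eq_bigr (fun w : k.-tuple bool =>
      h w * fine ((nu : probability _ _) [set x | cell_word g x k = w]))).
    apply: finite_range_Rintegral_dist (continuous_RP_integrable nu cf) _
      => [x|w|x].
    - exact: size_cell_word.
    - exact: mcode.
    - have [z zx gz] := cell_wordP g_surj x k.
      move: zx; rewrite /cylinder/= size_cell_word => <-.
      by rewrite -gz; exact: hE.
  by move=> w _; rewrite /mass /cell size_tuple.
have sumF : \sum_(w : k.-tuple bool) h w * mass w nu @[nu --> F] -->
    \sum_(w : k.-tuple bool) h w * m w.
  apply: cvg_big; first exact: add_continuous.
  by move=> w _; apply: cvgM; [exact: cvg_cst|have [] := mP w].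
have : \forall nu \near F, `|\sum_(w : k.-tuple bool) h w * m w -
    \sum_(w : k.-tuple bool) h w * mass w nu| <= e / 3.
  exact: (cvgr_dist_le _ _ sumF).
apply: (@filterS _ F) => nu hnu.
by move: mu_sum (nu_sum nu) hnu; rewrite !ler_norml; lra.
Qed.

End weak_compactness.

(** * Minimizers *)

Section minimizers.
Context (R : realType) (n : nat) (p : R).
Hypothesis p_gt0 : 0 < p.
Implicit Types mu : probability (RP R n) R.

Lemma energy_LE (q : R) mu : 0 < q ->
  energy (L_ p q) mu = I_ p mu - p / q * I_ q mu.
Proof.
move=> q0; rewrite /I_ /energy.
have L_potential y : \int[mu]_x L_ p q x y =
    potential (@frame R n p) mu y - p / q * potential (@frame R n q) mu y.
  rewrite /L_ RintegralB//; last first.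
  - exact: (integrableZl measurableT (p / q) (frame_integrable mu y q0)).
  - exact: frame_integrable.
  by rewrite RintegralZl//; exact: frame_integrable.
under eq_Rintegral do rewrite L_potential.
rewrite RintegralB//; last first.
- exact: (integrableZl measurableT (p / q) (potential_frame_integrable mu q0)).
- exact: potential_frame_integrable.
by rewrite RintegralZl//; exact: potential_frame_integrable.
Qed.

(** A continuous function on a nonempty compact space has a minimum; the Dirac mass only shows that
    there are probabilities. *)
Lemma M_nonempty : exists mu, M_ p mu.
Proof.
have [] := @compact_EVT_min (weak_probability R n) R (I_ p) setT.
- by exists (dirac (\pi_(RP R n) point)%qT : probability _ _).
- exact: weak_probability_compact.
- exact/continuous_subspaceT/I_continuous.
by move=> mu _ mumin; exists mu => mu'; apply: mumin; rewrite inE.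
Qed.

Lemma e_le mu : e_ n p <= I_ p mu.
Proof. by apply: ge_inf; [exists 0 => _ [la _ <-]; exact: I_ge0|exists mu]. Qed.

Lemma M_I mu : M_ p mu -> I_ p mu = e_ n p.
Proof.
move=> muM; apply/eqP; rewrite eq_le e_le andbT.
by apply: lb_le_inf; [exists (I_ p mu), mu|move=> _ [la _ <-]; exact: muM].
Qed.

Lemma I_M mu : I_ p mu <= e_ n p -> M_ p mu.
Proof. by move=> mue mu'; exact: le_trans mue (e_le mu'). Qed.

Lemma purity_le_astar mu : M_ p mu -> purity mu <= astar n p.
Proof.
move=> muM; apply: ub_le_sup; last by exists mu.
by exists 1 => _ [la _ <-]; exact: purity_le1.
Qed.

Lemma astar_le b : (forall mu, M_ p mu -> purity mu <= b) -> astar n p <= b.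
Proof.
move=> Mb; apply: ge_sup; last by move=> _ [mu muM <-]; exact: Mb.
by have [mu muM] := M_nonempty; exists (purity mu), mu.
Qed.

(* Comparing with a minimizer [mu] of [I_ p] bounds [purity mu <= I_ q mu] by
   an expression not involving [mu], so the supremum over [mu] can be taken. *)
Lemma minimizer_L_gap (q : nat) mu : p < q%:R -> minimizers (L_ p q%:R) mu ->
  I_ p mu - e_ n p <= p / q%:R * (I_ q%:R mu - astar n p).
Proof.
move=> pq mumin; have q0 : 0 < q%:R :> R := lt_trans p_gt0 pq.
have pq0 : 0 < p / q%:R by rewrite divr_gt0.
suff : astar n p <= I_ q%:R mu - (I_ p mu - e_ n p) / (p / q%:R).
  rewrite -(ler_pM2l pq0) mulrBr mulrCA divff ?gt_eqF// mulr1 lerBrDr => h.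
  by rewrite mulrBr lerBrDl.
apply: astar_le => la laM.
have := mumin la; rewrite !energy_LE// (M_I laM) => h.
have laq : purity la <= I_ q%:R la by apply: purity_le_I; rewrite -(ltr0n R).
apply: le_trans laq _; move: h pq0.
move: (p / q%:R) (I_ p mu) (I_ q%:R mu) (I_ q%:R la) (e_ n p) => r a b c e h r0.
by rewrite -(ler_pM2l r0) mulrBr mulrCA divff ?gt_eqF// mulr1; lra.
Qed.

Lemma minimizer_L_astar_le (q : nat) mu :
  p < q%:R -> minimizers (L_ p q%:R) mu -> astar n p <= I_ q%:R mu.
Proof.
move=> pq mumin; have q0 : 0 < q%:R :> R := lt_trans p_gt0 pq.
have pq0 : 0 < p / q%:R by rewrite divr_gt0.
rewrite -subr_ge0 -(pmulr_rge0 _ pq0).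
apply: le_trans (minimizer_L_gap pq mumin).
by rewrite subr_ge0 e_le.
Qed.

End minimizers.

(** * Asymptotics along even exponents *)

Section asymptotics.
Context (R : realType) (n : nat) (p : R) (nu : nat -> probability (RP R n) R).
Hypothesis p_gt0 : 0 < p.
Hypothesis nu_min : forall q : nat, ~~ odd q -> p < q%:R ->
  minimizers (L_ p q%:R) (nu q).
Local Notation weakP := (weak_probability R n).
Local Notation nuw := (nu : nat -> weakP).

Lemma near_even (P : nat -> Prop) :
  (\forall q \near \oo, ~~ odd q -> P q) -> \forall q \near even_oo, P q.
Proof. by []. Qed.

Lemma near_even_minimizer :
  \forall q \near even_oo, p < q%:R /\ minimizers (L_ p q%:R) (nu q).
Proof.
apply: near_even; near=> q => q_even.
have pq : p < q%:R by near: q; exact: nbhs_infty_gtr.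
by split => //; exact: nu_min.
Unshelve. all: by end_near. Qed.

(** A cluster point is a limit along a finer filter, and a closed condition passes to that limit.
    [H] is left free so as to cover [even_oo] and its restriction to a set of indices. *)
Lemma cluster_closed (H : set_system nat) (phi : weakP -> R) (C : set R)
    (mu : weakP) : ProperFilter H -> continuous phi -> closed C ->
  (\forall q \near H, C (phi (nu q))) -> cluster (nuw @ H) mu -> C (phi mu).
Proof.
move=> HF cphi cC HC; rewrite cluster_cvgE => -[G GF [Gmu HG]].
apply: (closed_cvg C cC (F := G) (u_ := phi)); first exact: HG.
exact: cvg_comp Gmu (cphi mu).
Qed.

Lemma cluster_purity_ge (H : set_system nat) (c : R) (mu : weakP) :
  ProperFilter H -> even_oo `<=` H ->
  (\forall q \near H, c <= I_ q%:R (nu q)) -> cluster (nuw @ H) mu ->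
  c <= purity mu.
Proof.
move=> HF evenH Hc clmu; apply: le_purity => m m0.
apply: (cluster_closed HF (phi := I_ m%:R) (C := [set t | c <= t])) clmu.
- by apply: I_continuous; rewrite ltr0n.
- exact: closed_ge.
- have Hm : \forall q \near H, (m <= q)%N.
    apply: evenH; apply: near_even; near=> q => _.
    by near: q; exact: nbhs_infty_ge.
  near=> q; have cq : c <= I_ q%:R (nu q) by near: q.
  have mq : (m <= q)%N by near: q.
  exact: le_trans cq (I_nincr (nu q) m0 mq).
Unshelve. all: by end_near. Qed.

Lemma cluster_M (mu : weakP) : cluster (nuw @ even_oo) mu -> M_ p mu.
Proof.
move=> clmu; apply: I_M; apply/ler_addgt0Pr => e e0.
apply: (cluster_closed _ (phi := I_ p) (C := [set t | t <= e_ n p + e])) clmu.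
- exact: I_continuous.
- exact: closed_le.
(* Since I_q <= 1 and [astar] >= 0, the gap is at most p / q, hence at most e for such q. *)
have near_pe : \forall q \near even_oo, p / e <= q%:R.
  by apply: near_even; near=> q => _; near: q; exact: nbhs_infty_ger.
near=> q.
have [pq qmin] : p < q%:R /\ minimizers (L_ p q%:R) (nu q).
  by near: q; exact: near_even_minimizer.
have q0 : 0 < q%:R :> R := lt_trans p_gt0 pq.
rewrite /= -lerBlDl; apply: le_trans (minimizer_L_gap p_gt0 pq qmin) _.
have a0 : 0 <= astar n p.
  have [la laM] := M_nonempty n p_gt0.
  apply: (le_trans _ (purity_le_astar laM)).
  by apply: le_purity => m m0; exact: I_ge0.
apply: (@le_trans _ _ (p / q%:R)).
  apply: ler_piMr; first by rewrite divr_ge0// ltW.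
  by rewrite lerBlDr (le_trans (I_le1 _ q0))// lerDl.
by rewrite ler_pdivrMr// -ler_pdivrMl// mulrC; near: q.
Unshelve. all: by end_near. Qed.

Lemma near_astar_le : \forall q \near even_oo, astar n p <= I_ q%:R (nu q).
Proof.
apply: filterS near_even_minimizer => q [pq qmin].
exact: minimizer_L_astar_le pq qmin.
Qed.

Lemma cluster_purity (mu : weakP) : cluster (nuw @ even_oo) mu ->
  purity mu = astar n p.
Proof.
move=> clmu; apply/eqP; rewrite eq_le purity_le_astar//; last exact: cluster_M.
exact: cluster_purity_ge near_astar_le clmu.
Qed.

Lemma near_I_lt e : 0 < e ->
  \forall q \near even_oo, I_ q%:R (nu q) < astar n p + e.
Proof.
move=> e0; apply: contrapT => nlt.
(* If the claim fails, the offending indices are frequent and [H] is proper. A cluster point along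
   [H] is also one along [even_oo], so its purity would be both [astar] and at least [astar] + e. *)
pose H := within [set q | astar n p + e <= I_ q%:R (nu q)] even_oo.
have HF : ProperFilter H.
  split; last exact: within_filter.
  move=> H0; apply: nlt; move: H0; apply: (@filterS _ even_oo) => q /= Hq.
  by rewrite ltNge; apply/negP => /Hq.
have evenH : even_oo `<=` H by move=> A; apply: (@filterS _ even_oo) => q.
have [mu [_ clmu]] : [set: weakP] `&` cluster (nuw @ H) !=set0.
  by apply: weak_probability_compact; exact: filterT.
have : astar n p + e <= purity mu.
  apply: cluster_purity_ge clmu => //.
  exact: withinT.
rewrite cluster_purity; first by rewrite gerDl leNgt e0.
by move=> A B eA muB; apply: clmu => //; exact: evenH.
Qed.

Lemma I_cvg_astar : I_ q%:R (nu q) @[q --> even_oo] --> astar n p.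
Proof.
apply/cvgrPdist_lt => e e0; near=> q.
rewrite ltr_distlC; apply/andP; split.
  apply: (@lt_le_trans _ _ (astar n p)); first by rewrite gtrBl.
  by near: q; exact: near_astar_le.
by near: q; exact: near_I_lt.
Unshelve. all: by end_near. Qed.

Lemma near_gap e : 0 < e -> \forall q \near even_oo,
  [/\ 0 <= I_ p (nu q) - e_ n p, I_ p (nu q) - e_ n p <= e * (q%:R)^-1,
    0 <= p / q%:R * (I_ q%:R (nu q) - astar n p) &
    p / q%:R * (I_ q%:R (nu q) - astar n p) <= e * (q%:R)^-1].
Proof.
move=> e0; have ep0 : 0 < e / p by rewrite divr_gt0.
near=> q.
have [pq qmin] : p < q%:R /\ minimizers (L_ p q%:R) (nu q).
  by near: q; exact: near_even_minimizer.
have q0 : 0 < q%:R :> R := lt_trans p_gt0 pq.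
have qa : astar n p <= I_ q%:R (nu q) by exact: minimizer_L_astar_le pq qmin.
(* The factor p / q turns the tolerance e / p of [near_I_lt] into e / q. *)
have pqe : p / q%:R * (I_ q%:R (nu q) - astar n p) <= e * (q%:R)^-1.
  rewrite mulrAC ler_pM2r ?invr_gt0// -ler_pdivlMl// mulrC lerBlDl ltW//.
  by near: q; exact: near_I_lt.
split => //.
- by rewrite subr_ge0 e_le.
- exact: le_trans (minimizer_L_gap p_gt0 pq qmin) pqe.
- by rewrite mulr_ge0 ?subr_ge0// divr_ge0// ltW.
Unshelve. all: by end_near. Qed.

End asymptotics.

Theorem proposition6p2 (R : realType) (d : nat) (d_ge2 : (2 <= d)%N)
    (p : R) (p_gt0 : 0 < p) (nu : nat -> probability (RP R d.-1) R)
    (nu_min : forall q : nat, ~~ odd q -> p < q%:R ->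
       minimizers (@L_ R d.-1 p q%:R) (nu q)) :
  [/\ forall mu : weak_probability R d.-1,
        cluster ((nu : nat -> weak_probability R d.-1) @ even_oo) mu ->
        M_ p mu /\ purity mu = astar d.-1 p,
      I_ q%:R (nu q) @[q --> even_oo] --> astar d.-1 p,
      (fun q : nat => I_ p (nu q) - e_ d.-1 p)
        =o_even_oo (fun q : nat => (q%:R : R)^-1) &
      (fun q : nat => I_ p (nu q) - p / q%:R * I_ q%:R (nu q))
        = (fun q : nat => e_ d.-1 p - p / q%:R * astar d.-1 p)
          +o_even_oo (fun q : nat => (q%:R : R)^-1)].
Proof.
split.
- by move=> mu clmu; split; [exact: cluster_M clmu|exact: cluster_purity clmu].
- exact: I_cvg_astar.
- apply/eqoP => e e0.
  apply: filterS (near_gap p_gt0 nu_min e0) => q [g0 ge _ _].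
  by rewrite ger0_norm// ger0_norm ?invr_ge0.
(* The remainder is the difference of two quantities that both lie in [0, e / q]. *)
- apply/eqaddoP => e e0; apply: filterS (near_gap p_gt0 nu_min e0) => q.
  move=> [g0 ge h0 he]; rewrite [X in _ <= e * X]ger0_norm ?invr_ge0//.
  change (`|I_ p (nu q) - p / q%:R * I_ q%:R (nu q) -
    (e_ d.-1 p - p / q%:R * astar d.-1 p)| <= e * (q%:R)^-1).
  move: g0 ge h0 he; rewrite mulrBr ler_norml.
  move: (e * _) (I_ p _) (_ * I_ _ _) (e_ _ _) (_ * astar _ _) => t A B E S.
  lra.
Qed.
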